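(* The poset $(\mathcal C_n,\preceq)$ is graded and its rank (the length of any maximal chain) equals $$\frac{9n^5-10n^3+4^{1+(-1)^n}\,n}{240}.$$
   Context: Let $[0,n]=\{0,\dots,n\}$. A corner-sum hypermatrix of order $n$ is an integer array $C=(C_{i,j,k})_{i,j,k\in[0,n]}$ such that for all $i,j\in[0,n]$: $C_{i,j,0}=C_{i,0,j}=C_{0,i,j}=0$, $C_{i,j,n}=C_{i,n,j}=C_{n,i,j}=ij$, and for all $k\in\{1,\dots,n\}$ each of $C_{i,j,k}-C_{i,j,k-1}$, $C_{i,k,j}-C_{i,k-1,j}$, $C_{k,i,j}-C_{k-1,i,j}$ is an integer in $\{\max(0,i+j-n),\dots,\min(i,j)\}$. $\mathcal C_n$ is the set of these, ordered by $C\preceq D$ iff $C\ge D$ entrywise. *)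

(* Defs.v *)
From mathcomp Require Import all_boot all_order all_algebra.
Set Implicit Arguments. Unset Strict Implicit. Unset Printing Implicit Defensive.
Import Order.TTheory GRing.Theory Num.Theory.
Local Open Scope ring_scope.

Definition hm (n : nat) := {ffun 'I_n.+1 * 'I_n.+1 * 'I_n.+1 -> int}.

(* Entry C_{i,j,k} with nat indices (only used for i,j,k <= n). *)
Definition ent (n : nat) (C : hm n) (i j k : nat) : int :=
  C (inord i, inord j, inord k).

(* x lies in {max(0,i+j-n), ..., min(i,j)} ; (i+j-n)%N is truncated subtraction. *)
Definition in_range (n i j : nat) (x : int) : bool :=
  ((Posz (i + j - n)%N <= x) && (x <= Posz (minn i j))).

Definition corner_sum (n : nat) (C : hm n) : Prop :=
  (forall i j : nat, (i <= n)%N -> (j <= n)%N ->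
     [/\ ent C i j 0 = 0, ent C i 0 j = 0 & ent C 0 i j = 0] /\
     [/\ ent C i j n = (i * j)%N%:Z, ent C i n j = (i * j)%N%:Z
       & ent C n i j = (i * j)%N%:Z]) /\
  (forall i j k : nat, (i <= n)%N -> (j <= n)%N -> (1 <= k <= n)%N ->
     [/\ in_range n i j (ent C i j k - ent C i j k.-1),
         in_range n i j (ent C i k j - ent C i k.-1 j)
       & in_range n i j (ent C k i j - ent C k.-1 i j)]).

Definition precede (n : nat) (C D : hm n) : Prop := forall x, D x <= C x.

Definition comparable_hm (n : nat) (C D : hm n) : Prop :=
  precede C D \/ precede D C.

Definition is_chain (n : nat) (s : seq (hm n)) : Prop :=
  [/\ uniq s, (forall C, C \in s -> corner_sum C)
    & (forall C D, C \in s -> D \in s -> comparable_hm C D)].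

Definition maximal_chain (n : nat) (s : seq (hm n)) : Prop :=
  is_chain s /\
  (forall D : hm n, corner_sum D ->
     (forall C, C \in s -> comparable_hm C D) -> D \in s).

Definition chain_length (n : nat) (s : seq (hm n)) : nat := (size s).-1.

(* Main.v *)
Require Import Defs.
From mathcomp Require Import all_boot all_order all_algebra.
From mathcomp Require Import zify ring lra.
Set Implicit Arguments. Unset Strict Implicit. Unset Printing Implicit Defensive.
Import Order.TTheory GRing.Theory Num.Theory.
Local Open Scope ring_scope.

(** Entrywise order turns corner-sum hypermatrices into the integer points of a system of
    difference constraints that has the strictly feasible interior point i j k / n.  Hence no
    set of entries is forced to move together: if C < D, then raising C by one at the entry
    with C < D that minimises C - i j k / n stays feasible.  Every cover therefore changes the
    sum of the entries by one, and a maximal chain has length equal to the difference of the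
    sums of the greatest and the least element, which are
      min (ij, ik, jk, n^2 - n(i+j+k) + ij + ik + jk) and
      max (0, k(i+j-n), j(i+k-n), i(j+k-n)).
    For i <= j, summing their difference over k gives a b (n - max (a, b)) with a = i and
    b = n - j; the remaining sum over the triangle a + b <= n depends on the parity of n. *)

(** * Entrywise order and sums of entries *)

Definition entry_sum (n : nat) (C : hm n) : int := \sum_x C x.

(** This is the reverse of [precede]. Comparability, chains and their lengths do not change when the
    order is reversed, so the proof works with the entrywise order. *)
Definition hm_le (n : nat) (C D : hm n) : Prop := forall x, C x <= D x.

Lemma hm_le_trans (n : nat) (C D E : hm n) : hm_le C D -> hm_le D E -> hm_le C E.
Proof. by move=> CD DE x; apply: le_trans (CD x) (DE x). Qed.

Lemma entry_sum_le (n : nat) (C D : hm n) :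
  hm_le C D -> entry_sum C <= entry_sum D.
Proof. by move=> CD; apply: ler_sum => x _; apply: CD. Qed.

Lemma entry_sum_inj (n : nat) (C D : hm n) :
  hm_le C D -> entry_sum C = entry_sum D -> C = D.
Proof.
move=> CD eqs; have /eqP : \sum_x (D x - C x) = 0.
  by rewrite sumrB -/(entry_sum D) -/(entry_sum C) eqs subrr.
rewrite psumr_eq0; last by move=> x _; rewrite subr_ge0.
move=> /allP h; apply/ffunP => x; have := h x (mem_index_enum x).
by rewrite /= subr_eq0 => /eqP.
Qed.

(** In the opposite case [D <= C] the two sums coincide, which forces [C = D]. Inside a chain the
    order is thus read off from the sums. *)
Lemma chain_le (n : nat) (C D : hm n) :
  comparable_hm C D -> entry_sum C <= entry_sum D -> hm_le C D.
Proof.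
move=> [DC|//] le_s; have {}DC : hm_le D C by [].
have e : entry_sum D = entry_sum C.
  by apply/eqP; rewrite eq_le le_s andbT entry_sum_le.
by rewrite (entry_sum_inj DC e).
Qed.

(** * Unit steps between corner-sum hypermatrices *)

Lemma entE (n : nat) (C : hm n) (x : 'I_n.+1 * 'I_n.+1 * 'I_n.+1) :
  C x = ent C x.1.1 x.1.2 x.2.
Proof. by rewrite /ent !inord_val -!surjective_pairing. Qed.

(** Boundary entries are prescribed, so two corner sums can differ only in the interior. There the
    point ijk/n satisfies the range conditions strictly. *)
Lemma corner_sum_boundary (n : nat) (C D : hm n) x :
  corner_sum C -> corner_sum D -> C x != D x ->
  [/\ 0 < x.1.1 < n, 0 < x.1.2 < n & 0 < x.2 < n]%N.
Proof.
case: x => [[i j] k] [bC _] [bD _] /=; rewrite !entE /=.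
have [[leI leJ] leK] := (ltn_ord i, ltn_ord j, ltn_ord k); rewrite !ltnS in leI leJ leK.
move: (nat_of_ord i) (nat_of_ord j) (nat_of_ord k) leI leJ leK => {}i {}j {}k iN jN kN.
have [[a1 _ _] [a2 _ _]] := bC i j iN jN; have [[b1 _ _] [b2 _ _]] := bD i j iN jN.
have [[_ a3 _] [_ a4 _]] := bC i k iN kN; have [[_ b3 _] [_ b4 _]] := bD i k iN kN.
have [[_ _ a5] [_ _ a6]] := bC j k jN kN; have [[_ _ b5] [_ _ b6]] := bD j k jN kN.
move=> ne; split; rewrite !lt0n !ltn_neqAle ?iN ?jN ?kN ?andbT; apply/andP; split;
  apply: contraNneq ne => e; subst; apply/eqP; congruence.
Qed.

Definition raise_at (n : nat) (C : hm n) x : hm n := [ffun y => C y + (y == x)%:Z].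

Lemma entry_sum_raise_at (n : nat) (C : hm n) x :
  entry_sum (raise_at C x) = entry_sum C + 1.
Proof.
rewrite /entry_sum; under eq_bigr do rewrite ffunE.
rewrite big_split /=; congr (_ + _).
by rewrite (bigD1 x) //= eqxx big1 ?addr0 // => y /negbTE ->.
Qed.

(* The strictly feasible real point ijk/n is scaled by n to stay integral. *)
Definition vol (n : nat) (x : 'I_n.+1 * 'I_n.+1 * 'I_n.+1) : int :=
  (x.1.1 * x.1.2 * x.2)%N%:Z.

(** Let [x = p]. If [C q = D q], then [C p + 1 <= D p] and the upper bound is inherited from [D].
    Otherwise minimality of [x] gives n (C p - C q) <= ij < n min(i,j), which leaves room for 1. The
    case [x = q] is dual: the lower bound comes from [D], or from n (i+j-n) < ij. *)
Lemma raise_at_edge (n : nat) (C D : hm n) x p q (i j : nat) :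
  hm_le C D -> C x < D x ->
  (forall y, C y < D y -> n%:Z * C x - vol x <= n%:Z * C y - vol y) ->
  p != q -> vol p - vol q = (i * j)%N%:Z ->
  (x = p \/ x = q -> (0 < i < n)%N /\ (0 < j < n)%N) ->
  in_range n i j (C p - C q) -> in_range n i j (D p - D q) ->
  in_range n i j (raise_at C x p - raise_at C x q).
Proof.
move=> CD ltx minx pq volpq inner; rewrite /in_range /raise_at !ffunE.
have [ep|np] := eqVneq p x.
  subst p; have [hi hj] := inner (or_introl erefl).
  rewrite eq_sym (negbTE pq) /=.
  have := CD q; rewrite le_eqVlt => /orP[/eqP e|/minx m]; first by lia.
  have lt1 : (i * j < n * minn i j)%N by rewrite /minn; case: ifP => ?; nia.
  move=> /andP[l1 l2] _; apply/andP; split; first by lia.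
  have : n%:Z * (C x - C q) < n%:Z * (minn i j)%:Z by lia.
  rewrite ltr_pM2l; lia.
have [eq|nq] := eqVneq q x; last by rewrite !addr0.
subst q; have [hi hj] := inner (or_intror erefl).
have := CD p; rewrite le_eqVlt => /orP[/eqP e|/minx m]; first by lia.
have lt1 : (n * (i + j - n) < i * j)%N.
  have [le|lt] := leqP (i + j) n; first by rewrite (eqP le) muln0; nia.
  (* Here ij - n (i+j-n) = (n-i)(n-j) = uv > 0. *)
  have [u eu] : exists u, (n = i + u)%N by exists (n - i)%N; lia.
  have [v ev] : exists v, (n = j + v)%N by exists (n - j)%N; lia.
  nia.
move=> /andP[l1 l2] _; apply/andP; split; last by lia.
have : n%:Z * (i + j - n)%N%:Z < n%:Z * (C p - C x) by lia.
rewrite ltr_pM2l; lia.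
Qed.

Lemma vol_inord (n i j k : nat) : (i <= n)%N -> (j <= n)%N -> (k <= n)%N ->
  vol (inord i : 'I_n.+1, inord j : 'I_n.+1, inord k : 'I_n.+1) = (i * j * k)%N%:Z.
Proof. by move=> *; rewrite /vol /= !inordK. Qed.

Lemma inord_neq_pred (n k : nat) :
  (1 <= k <= n)%N -> inord k != inord k.-1 :> 'I_n.+1.
Proof.
by move=> kn; apply/eqP => /(congr1 val) /=; rewrite !inordK; lia.
Qed.

(** Since [x] is interior, the prescribed boundary values survive. Each range condition concerns two
    neighbours whose volumes differ by the product of the two fixed coordinates, so [raise_at_edge]
    applies in all three directions. *)
Lemma corner_sum_raise_at (n : nat) (C D : hm n) x :
  corner_sum C -> corner_sum D -> hm_le C D -> C x < D x ->
  (forall y, C y < D y -> n%:Z * C x - vol x <= n%:Z * C y - vol y) ->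
  corner_sum (raise_at C x).
Proof.
move=> cC cD CD ltx minx.
have [xi xj xk] := corner_sum_boundary cC cD (negbT (lt_eqF ltx)).
have off i j k : (i <= n)%N -> (j <= n)%N -> (k <= n)%N ->
    ~~ [&& 0 < i < n, 0 < j < n & 0 < k < n]%N ->
    ent (raise_at C x) i j k = ent C i j k.
  move=> iN jN kN out; rewrite /ent ffunE; case: eqVneq => [e|_]; last by rewrite addr0.
  by move: out xi xj xk; rewrite -e /= !inordK // => /negP out *; case: out; apply/and3P.
have at_x i j k : (i <= n)%N -> (j <= n)%N -> (k <= n)%N ->
    x = (inord i, inord j, inord k) -> [/\ 0 < i < n, 0 < j < n & 0 < k < n]%N.
  by move=> iN jN kN e; move: xi xj xk; rewrite e /= !inordK.
split=> [i j iN jN|i j k iN jN kN].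
  have [[? ? ?] [? ? ?]] := cC.1 i j iN jN.
  by do 2!split; rewrite off // ?ltnn ?andbF.
have [kN1 kN2] : (k <= n)%N /\ (k.-1 <= n)%N by lia.
have [c1 c2 c3] := cC.2 i j k iN jN kN; have [d1 d2 d3] := cD.2 i j k iN jN kN.
split; apply: (raise_at_edge CD ltx minx) => //.
- by apply: contraTneq (inord_neq_pred kN) => -[->]; rewrite eqxx.
- by rewrite !vol_inord //; nia.
- by case=> /at_x[].
- by apply: contraTneq (inord_neq_pred kN) => -[->]; rewrite eqxx.
- by rewrite !vol_inord //; nia.
- by case=> /at_x[].
- by apply: contraTneq (inord_neq_pred kN) => -[->]; rewrite eqxx.
- by rewrite !vol_inord //; nia.
- by case=> /at_x[].
Qed.

Lemma corner_sum_step (n : nat) (C D : hm n) :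
  corner_sum C -> corner_sum D -> hm_le C D -> C != D ->
  exists E, [/\ corner_sum E, hm_le C E, hm_le E D &
                entry_sum E = entry_sum C + 1].
Proof.
move=> cC cD CD neCD.
have [x0 ltx0] : exists x, C x < D x.
  apply/existsP; apply: contraNT neCD; rewrite negb_exists => /forallP h.
  by apply/eqP/ffunP => y; apply/eqP; rewrite eq_le CD leNgt h.
case: (@Order.TotalTheory.arg_minP _ _ _ x0 (fun x => C x < D x)
         (fun x => n%:Z * C x - vol x) ltx0) => x ltx minx.
exists (raise_at C x); split.
- exact: corner_sum_raise_at ltx minx.
- by move=> y; rewrite ffunE lerDl.
- by move=> y; rewrite ffunE; case: eqVneq => [->|_]; [rewrite lezD1 | rewrite addr0].
- exact: entry_sum_raise_at.
Qed.

Lemma corner_sum_interpolate (n : nat) (C D : hm n) (d : nat) :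
  corner_sum C -> corner_sum D -> hm_le C D ->
  entry_sum C + d%:Z <= entry_sum D ->
  exists E, [/\ corner_sum E, hm_le C E, hm_le E D &
                entry_sum E = entry_sum C + d%:Z].
Proof.
move=> cC cD CD; elim: d => [|d IHd] le_d.
  by exists C; split=> //; rewrite addr0.
have [|E [cE CE ED eE]] := IHd; first by lia.
have [|F [cF EF FD eF]] := corner_sum_step cE cD ED.
  by apply: contraTneq le_d => e; rewrite -e eE; lia.
exists F; split=> //; first exact: hm_le_trans EF.
by rewrite eF eE; lia.
Qed.

(** * Chains between a least and a greatest element *)

Lemma comparable_hm_le (n : nat) (C D : hm n) :
  hm_le C D \/ hm_le D C -> comparable_hm C D.
Proof. by case=> h; [right|left]. Qed.

Section Extremes.
Variables (n : nat) (B T : hm n) (d : nat).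
Hypotheses (cB : corner_sum B) (cT : corner_sum T).
Hypothesis bound : forall C, corner_sum C -> hm_le B C /\ hm_le C T.
Hypothesis sumBT : entry_sum T = entry_sum B + d%:Z.

Lemma chain_below (s : seq (hm n)) (C D : hm n) :
  is_chain s -> C \in s -> D \in s -> entry_sum C <= entry_sum D -> hm_le C D.
Proof. by case=> _ _ cmp Cs Ds; apply: chain_le; apply: cmp. Qed.

(** The absolute value only serves to land in [nat]: by [bound] the difference is nonnegative on
    corner sums. *)
Definition level (C : hm n) : nat := absz (entry_sum C - entry_sum B).

Lemma levelE (C : hm n) : corner_sum C ->
  entry_sum C = entry_sum B + (level C)%:Z /\ (level C <= d)%N.
Proof.
move=> /bound[/entry_sum_le BC /entry_sum_le CT].
rewrite /level; move: BC CT; rewrite sumBT; lia.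
Qed.

Lemma uniq_level (s : seq (hm n)) : is_chain s -> uniq (map level s).
Proof.
move=> ch; case: (ch) => us cs cmp; rewrite map_inj_in_uniq // => C D Cs Ds e.
have [eC _] := levelE (cs C Cs); have [eD _] := levelE (cs D Ds).
have eCD : entry_sum C = entry_sum D by rewrite eC eD e.
by apply: (entry_sum_inj _ eCD); apply: (chain_below ch) => //; rewrite eCD.
Qed.

Lemma level_subset (s : seq (hm n)) :
  is_chain s -> {subset map level s <= iota 0 d.+1}.
Proof.
move=> [_ cs _] _ /mapP[C /cs/levelE[_ ?] ->]; rewrite mem_iota; lia.
Qed.

(** Pigeonhole: the levels of a chain are distinct elements of {0, ..., d}. *)
Lemma size_chain (s : seq (hm n)) : is_chain s -> (size s <= d.+1)%N.
Proof.
move=> ch; rewrite -(size_map level) -(size_iota 0 d.+1).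
exact: uniq_leq_size (uniq_level ch) (level_subset ch).
Qed.

Lemma is_chain_cons (s : seq (hm n)) (D : hm n) :
  is_chain s -> corner_sum D -> (forall C, C \in s -> comparable_hm C D) ->
  D \notin s -> is_chain (D :: s).
Proof.
move=> [us cs cmp] cD cmpD Ds; split=> [|C|C E]; first by rewrite /= Ds.
  by rewrite inE => /orP[/eqP -> //|/cs].
rewrite !inE => /orP[/eqP->|Cs] /orP[/eqP->|Es]; last exact: cmp.
- by left.
- by case: (cmpD E Es); [right|left].
- exact: cmpD.
Qed.

Lemma full_chain_maximal (s : seq (hm n)) :
  is_chain s -> size s = d.+1 -> maximal_chain s.
Proof.
move=> ch sz; split=> // D cD cmpD; apply: contraT => Ds.
by have := size_chain (is_chain_cons ch cD cmpD Ds); rewrite /= sz ltnn.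
Qed.

Lemma exists_full_chain : exists s : seq (hm n), is_chain s /\ size s = d.+1.
Proof.
(* The induction carries the top element [C] of the chain, at level [k]. A unit step up from [C] is
   then above the whole chain. *)
suff H k : (k <= d)%N -> exists (s : seq (hm n)) (C : hm n),
    [/\ is_chain s, size s = k.+1, C \in s, forall E, E \in s -> hm_le E C
      & entry_sum C = entry_sum B + k%:Z].
  by have [s [C [ch sz _ _ _]]] := H d (leqnn d); exists s.
elim: k => [_|k IHk ltk].
  exists [:: B], B; split=> //; rewrite ?mem_head ?addr0 //; last first.
    by move=> E; rewrite inE => /eqP ->.
  split=> // [C|C E]; rewrite !inE; first by move/eqP ->.
  by move=> /eqP-> /eqP->; left.
have [s [C [ch sz Cs topC eC]]] := IHk (ltnW ltk).
have cC : corner_sum C by case: ch => _ cs _; apply: cs.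
have [|E [cE CE _ eE]] := corner_sum_interpolate (d := 1) cC cT (proj2 (bound cC)).
  by rewrite eC sumBT; lia.
have sE F : F \in s -> hm_le F E by move=> /topC FC; apply: hm_le_trans CE.
exists (E :: s), E; split=> //=; rewrite ?mem_head ?sz //.
- apply: is_chain_cons => // [F /sE FE|]; first by right.
  apply/negP => /topC/entry_sum_le; rewrite eE; lia.
- by move=> F; rewrite inE => /orP[/eqP -> //|/sE].
- by rewrite eE eC; lia.
Qed.

Lemma extremes_mem (s : seq (hm n)) : maximal_chain s -> B \in s /\ T \in s.
Proof.
move=> [[_ cs _] mx]; split; apply: mx => // C /cs/bound[BC CT].
  by apply: comparable_hm_le; right.
by apply: comparable_hm_le; left.
Qed.

(** Take the chain elements [C] and [D] nearest to level [v] from below and from above.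
    Interpolation gives some [E] at level [v] between them. Every chain element is below [C] or
    above [D], hence comparable to [E], and maximality puts [E] into the chain. *)
Lemma maximal_chain_level (s : seq (hm n)) (v : nat) :
  maximal_chain s -> (v <= d)%N -> v \in map level s.
Proof.
move=> ms vd; have [Bs Ts] := extremes_mem ms.
have [ch mx] := ms; have [_ cs _] := ch.
have levB : level B = 0%N by rewrite /level subrr.
have levT : level T = d by rewrite /level sumBT; lia.
pose below C := (C \in s) && (level C <= v)%N.
pose above C := (C \in s) && (v <= level C)%N.
have [C [/andP[Cs Cv] maxC]] : exists C, below C /\ forall E, below E -> (level E <= level C)%N.
  have ex : exists l, has (fun C => (level C <= v)%N && (level C == l)) s.
    by exists 0%N; apply/hasP; exists B; rewrite // levB.
  have ub l : has (fun C => (level C <= v)%N && (level C == l)) s -> (l <= v)%N.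
    by case/hasP => C _ /andP[? /eqP <-].
  case: (ex_maxnP ex ub) => l /hasP[C Cs /andP[Cv /eqP el]] mxl.
  exists C; split=> [|E /andP[Es Ev]]; first exact/andP.
  by rewrite el; apply: mxl; apply/hasP; exists E; rewrite // Ev eqxx.
have [D [/andP[Ds Dv] minD]] : exists D, above D /\ forall E, above E -> (level D <= level E)%N.
  have ex : exists l, has (fun C => (v <= level C)%N && (level C == l)) s.
    by exists d; apply/hasP; exists T; rewrite // levT vd /=.
  case: (ex_minnP ex) => l /hasP[D Ds /andP[Dv /eqP el]] mnl.
  exists D; split=> [|E /andP[Es Ev]]; first exact/andP.
  by rewrite el; apply: mnl; apply/hasP; exists E; rewrite // Ev eqxx.
have [eC _] := levelE (cs C Cs); have [eD _] := levelE (cs D Ds).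
have CD : hm_le C D by apply: (chain_below ch) => //; rewrite eC eD; lia.
have [|E [cE CE ED eE]] :=
    corner_sum_interpolate (d := (v - level C)%N) (cs C Cs) (cs D Ds) CD.
  by rewrite eC eD; lia.
have lE : level E = v by rewrite /level eE eC; lia.
rewrite -lE; apply/map_f/mx => // F Fs; apply: comparable_hm_le.
have [eF _] := levelE (cs F Fs).
have [Fv|/ltnW Fv] := leqP (level F) v.
  left; apply: hm_le_trans CE; apply: (chain_below ch) => //.
  by rewrite eF eC; have := maxC F; rewrite /below Fs Fv => /(_ isT); lia.
right; apply: hm_le_trans ED _; apply: (chain_below ch) => //.
by rewrite eF eD; have := minD F; rewrite /above Fs Fv => /(_ isT); lia.
Qed.

Lemma size_maximal_chain (s : seq (hm n)) : maximal_chain s -> size s = d.+1.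
Proof.
move=> ms; apply/eqP; rewrite eqn_leq size_chain; last by case: ms.
rewrite -(size_map level) -[leqLHS](size_iota 0); apply: uniq_leq_size (iota_uniq _ _) _.
by move=> v; rewrite mem_iota add0n ltnS => /= vd; apply: maximal_chain_level.
Qed.

End Extremes.

(** * The two extreme corner-sum hypermatrices *)

Lemma telescope_bounds (n lo : nat) (u : nat -> int) (k : nat) :
  (k <= n)%N -> u 0%N = 0 ->
  (forall l, (1 <= l <= n)%N -> lo%:Z <= u l - u l.-1) ->
  (k * lo)%N%:Z <= u k <= u n - ((n - k) * lo)%N%:Z.
Proof.
move=> kn u0 step.
have mono a b : (a + b <= n)%N -> u a + (b * lo)%N%:Z <= u (a + b)%N.
  elim: b => [|b IHb] ab; first by rewrite mul0n addr0 addn0.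
  have := step (a + b).+1; have := IHb; rewrite /= addnS mulSn; lia.
have := mono 0%N k; have := mono k (n - k)%N; rewrite subnKC // add0n u0; lia.
Qed.

(* The last term is n^2 - n(i+j+k) + ij + ik + jk, hence symmetric. *)
Definition upper (n i j k : nat) : int :=
  Order.min (Order.min (i%:Z * j%:Z) (j%:Z * k%:Z))
    (Order.min (i%:Z * k%:Z) (i%:Z * j%:Z - (n%:Z - k%:Z) * (i%:Z + j%:Z - n%:Z))).

Definition lower (n i j k : nat) : int :=
  Order.max (Order.max 0 (k%:Z * (i%:Z + j%:Z - n%:Z)))
    (Order.max (j%:Z * (i%:Z + k%:Z - n%:Z)) (i%:Z * (j%:Z + k%:Z - n%:Z))).

Definition hm_of (n : nat) (f : nat -> nat -> nat -> int) : hm n :=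
  [ffun x : 'I_n.+1 * 'I_n.+1 * 'I_n.+1 => f x.1.1 x.1.2 x.2].

Lemma ent_hm_of (n : nat) f (i j k : nat) : (i <= n)%N -> (j <= n)%N -> (k <= n)%N ->
  ent (hm_of n f) i j k = f i j k.
Proof. by move=> *; rewrite /ent ffunE /= !inordK. Qed.

(** Telescoping along each axis bounds an entry below when counting from the face 0, and above when
    counting back from the face n. *)
Lemma corner_sum_bounds (n : nat) (C : hm n) : corner_sum C ->
  hm_le (hm_of n (lower n)) C /\ hm_le C (hm_of n (upper n)).
Proof.
move=> [bC eC].
suff H x : hm_of n (lower n) x <= C x <= hm_of n (upper n) x.
  by split=> x; case/andP: (H x).
case: x => [[i j] k]; rewrite !ffunE entE /=.
have [[leI leJ] leK] := (ltn_ord i, ltn_ord j, ltn_ord k); rewrite !ltnS in leI leJ leK.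
move: (nat_of_ord i) (nat_of_ord j) (nat_of_ord k) leI leJ leK => {}i {}j {}k iN jN kN.
have [[z1 _ _] [t1 _ _]] := bC i j iN jN.
have [[_ z2 _] [_ t2 _]] := bC i k iN kN.
have [[_ _ z3] [_ _ t3]] := bC j k jN kN.
have := @telescope_bounds n (i + j - n) (fun l => ent C i j l) k kN z1.
have := @telescope_bounds n (i + k - n) (fun l => ent C i l k) j jN z2.
have := @telescope_bounds n (j + k - n) (fun l => ent C l j k) i iN z3.
rewrite t1 t2 t3 => h3 h2 h1.
have {h3} := h3 (fun l ln => proj1 (andP (let: And3 _ _ h := eC j k l jN kN ln in h))).
have {h2} := h2 (fun l ln => proj1 (andP (let: And3 _ h _ := eC i k l iN kN ln in h))).
have {h1} := h1 (fun l ln => proj1 (andP (let: And3 h _ _ := eC i j l iN jN ln in h))).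
move=> /andP[/= l1 u1] /andP[/= l2 u2] /andP[/= l3 u3].
(* The telescoped bounds use truncated subtraction, whereas [lower] and [upper] use the integer
   difference. *)
have le_sub a b c : c%:Z * (a%:Z + b%:Z - n%:Z) <= (c * (a + b - n))%N%:Z by nia.
rewrite /lower /upper !ge_max !le_min (le_trans (le_sub _ _ _) l1).
rewrite (le_trans (le_sub _ _ _) l2) (le_trans (le_sub _ _ _) l3) (le_trans _ l1) //=.
have slack a b c : (a * b)%N%:Z - ((n - c) * (a + b - n))%N%:Z <= a%:Z * b%:Z.
  by rewrite PoszM lerBlDr lerDl.
rewrite (le_trans u1 (slack _ _ _)) (le_trans u2 (slack _ _ _)).
rewrite (le_trans u3 (slack _ _ _)) /=.
by apply: le_trans u1 _; rewrite PoszM lerD2l lerN2 subzn.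
Qed.

(** Symmetry of [f] reduces the three directions to the last one, and the pairs (i,j) to i <= j. *)
Lemma corner_sum_hm_of (n : nat) (f : nat -> nat -> nat -> int) :
  (forall i j k, f i j k = f j i k) -> (forall i j k, f i j k = f i k j) ->
  (forall i j, (i <= n)%N -> (j <= n)%N -> f i j 0%N = 0 /\ f i j n = (i * j)%N%:Z) ->
  (forall i j k, (i <= j)%N -> (j <= n)%N -> (k < n)%N ->
     in_range n i j (f i j k.+1 - f i j k)) ->
  corner_sum (hm_of n f).
Proof.
move=> f12 f23 bf sf.
have {}sf i j k : (i <= n)%N -> (j <= n)%N -> (1 <= k <= n)%N ->
    in_range n i j (f i j k - f i j k.-1).
  case: k => [//|k] iN jN kN; have [ij|/ltnW ji] := leqP i j; first exact: sf.
  by rewrite !(f12 i j) /in_range addnC minnC; apply: sf.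
split=> [i j iN jN|i j k iN jN kN].
  have [z t] := bf i j iN jN.
  by rewrite !ent_hm_of // (f12 n i) (f12 0%N i) !(f23 i n) !(f23 i 0%N).
have kN' : (k.-1 <= n)%N by lia.
have kN'' : (k <= n)%N by lia.
rewrite !ent_hm_of // (f12 k i) (f12 k.-1 i) !(f23 i k) !(f23 i k.-1).
by split; apply: sf.
Qed.

Lemma upperE (n i j k : nat) : (i <= j)%N -> (j <= n)%N -> (k <= n)%N ->
  upper n i j k = if (i + j <= n)%N then (i * minn j k)%N%:Z
                  else (i * k)%N%:Z - ((n - j) * (i + k - n))%N%:Z.
Proof.
move=> ij jn kn; apply/eqP; rewrite eq_le /upper !ge_min !le_min.
(* Slack variables turn the order hypotheses into equations, so that only polynomial inequalities
   over naturals remain. *)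
have [w ew] : exists w, n = (j + w)%N by exists (n - j)%N; lia.
have [v ev] : exists v, n = (k + v)%N by exists (n - k)%N; lia.
have [u eu] : exists u, j = (i + u)%N by exists (j - i)%N; lia.
have [ijn|ijn] := leqP (i + j) n.
  have [jk|/ltnW kj] := leqP j k; first by nia.
  by nia.
have [ikn|/ltnW ikn] := leqP (i + k) n.
  have -> : (i + k - n)%N = 0%N by lia.
  by nia.
have [t et] : exists t, (i + k)%N = (n + t)%N by exists (i + k - n)%N; lia.
rewrite et addKn.
by nia.
Qed.

(** The order-reversing reflection sending C_{i,j,k} to ij - C_{i,j,n-k} exchanges the two extremes;
    properties of [upper] pass to [lower] through it. *)
Lemma lower_upper (n i j k : nat) : (k <= n)%N ->
  lower n i j k = (i * j)%N%:Z - upper n i j (n - k).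
Proof.
move=> kn; rewrite /lower /upper.
have -> : (n - k)%N%:Z = n%:Z - k%:Z by lia.
lia.
Qed.

Lemma upper_symm12 (n i j k : nat) : upper n i j k = upper n j i k.
Proof. by rewrite /upper; lia. Qed.

Lemma upper_symm23 (n i j k : nat) : upper n i j k = upper n i k j.
Proof. by rewrite /upper; lia. Qed.

Lemma lower_symm12 (n i j k : nat) : lower n i j k = lower n j i k.
Proof. by rewrite /lower; lia. Qed.

Lemma lower_symm23 (n i j k : nat) : lower n i j k = lower n i k j.
Proof. by rewrite /lower; lia. Qed.

Lemma upper_boundary (n i j : nat) : (i <= n)%N -> (j <= n)%N ->
  upper n i j 0 = 0 /\ upper n i j n = (i * j)%N%:Z.
Proof.
wlog ij : i j / (i <= j)%N => [H iN jN|_ jN].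
  case/orP: (leq_total i j) => [ij|ji]; first exact: H.
  by rewrite !(upper_symm12 n i) mulnC; apply: H.
rewrite !upperE // minn0 (minn_idPl jN) addnK !addn0.
have -> : (i - n)%N = 0%N by lia.
by case: leqP => ? ; split; nia.
Qed.

(** As k grows, [upper] first takes the largest allowed increment i and then the smallest, which is
    0 or i+j-n. *)
Lemma upper_step (n i j k : nat) : (i <= j)%N -> (j <= n)%N -> (k < n)%N ->
  in_range n i j (upper n i j k.+1 - upper n i j k).
Proof.
move=> ij jN kN; rewrite !upperE // ?(ltnW kN) // /in_range.
case: leqP => ijn.
  have -> : (i + j - n)%N = 0%N by lia.
  have [jk|kj] := leqP j k.
    by rewrite (minn_idPl (leqW jk)); lia.
  by rewrite (minn_idPr kj); nia.
have [ikn|ikn] := ltnP (i + k) n.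
  have -> : (i + k.+1 - n)%N = 0%N by lia.
  have -> : (i + k - n)%N = 0%N by lia.
  by nia.
have -> : (i + k.+1 - n)%N = (i + k - n).+1 by lia.
by rewrite !mulnS; lia.
Qed.

Lemma corner_sum_upper (n : nat) : corner_sum (hm_of n (upper n)).
Proof.
apply: corner_sum_hm_of; [exact: upper_symm12|exact: upper_symm23| |].
- exact: upper_boundary.
- exact: upper_step.
Qed.

Lemma corner_sum_lower (n : nat) : corner_sum (hm_of n (lower n)).
Proof.
apply: corner_sum_hm_of => [i j k|i j k|i j iN jN|i j k ij jN kN].
- exact: lower_symm12.
- exact: lower_symm23.
- have [u0 un] := upper_boundary iN jN.
  by rewrite !lower_upper // subn0 subnn u0 un subrr subr0.
rewrite !lower_upper ?(ltnW kN) //.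
have := @upper_step n i j (n - k.+1) ij jN.
have -> : (n - k.+1).+1 = (n - k)%N by lia.
by move=> /(_ (leq_subr _ _)); rewrite /in_range; lia.
Qed.

(** * The rank as a sum over a triangle *)

Lemma sum_subn_ord (j n : nat) : (j <= n)%N ->
  (2 * \sum_(k < n.+1) (j - k) = j * j.+1)%N.
Proof.
elim: n j => [|n IHn] [|j] // jn.
- by rewrite big1 // => k _; rewrite sub0n.
- by rewrite big1 // => k _; rewrite sub0n.
- rewrite big_ord_recl mulnDr.
  under eq_bigr do rewrite lift0 subSS.
  by rewrite IHn // subn0; lia.
Qed.

(** Since min(j,k) = j - (j-k) with truncated subtraction, and k -> n-k turns the second term into
    j-k, the sum is (n+1) j - j (j+1). *)
Lemma sum_minn_subn (j n : nat) : (j <= n)%N ->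
  \sum_(k < n.+1) ((minn j k)%:Z - (j - (n - k))%N%:Z) = (j * (n - j))%N%:Z.
Proof.
move=> jn; rewrite sumrB [X in _ - X](reindex_inj rev_ord_inj) /=.
have -> : \sum_(k < n.+1) (j - (n - (n.+1 - k.+1)))%N%:Z = \sum_(k < n.+1) (j - k)%N%:Z :> int.
  by apply: eq_bigr => k _; congr Posz; have := ltn_ord k; lia.
have -> : \sum_(k < n.+1) (minn j k)%:Z
    = \sum_(k < n.+1) j%:Z - \sum_(k < n.+1) (j - k)%N%:Z :> int.
  by rewrite -sumrB; apply: eq_bigr => k _; lia.
have := sum_subn_ord jn.
rewrite sumr_const card_ord -(big_morph Posz PoszD (erefl (0%N : int))).
move: (\sum_(k < n.+1) (j - k))%N => S; rewrite -mulr_natr.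
nia.
Qed.

(* Used with a = min (i, j) and b = n - max (i, j). *)
Definition row_rank (n a b : nat) : nat := (a * b * (n - maxn a b))%N.

(** Each summand is a constant multiple of one in [sum_minn_subn]: i times the summand for j if i+j
    <= n, and n-j times the summand for i otherwise. *)
Lemma sum_upper_lower (n i j : nat) : (i <= j)%N -> (j <= n)%N ->
  \sum_(k < n.+1) (upper n i j k - lower n i j k) = (row_rank n i (n - j))%:Z.
Proof.
move=> ij jn; rewrite /row_rank; have [ijn|ijn] := leqP (i + j) n.
  have -> : (n - maxn i (n - j) = j)%N by lia.
  have -> : (i * (n - j) * j)%N%:Z = i%:Z * (j * (n - j))%N%:Z by lia.
  rewrite -sum_minn_subn // mulr_sumr; apply: eq_bigr => k _.
  have kn : (k <= n)%N by rewrite -ltnS.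
  rewrite lower_upper // !upperE ?leq_subr // ijn !PoszM.
  have -> : (minn j (n - k))%:Z = j%:Z - (j - (n - k))%N%:Z by lia.
  ring.
have -> : (n - maxn i (n - j) = n - i)%N by lia.
have -> : (i * (n - j) * (n - i))%N%:Z = (n - j)%N%:Z * (i * (n - i))%N%:Z by lia.
rewrite -sum_minn_subn ?(leq_trans ij) // mulr_sumr; apply: eq_bigr => k _.
have kn : (k <= n)%N by rewrite -ltnS.
rewrite lower_upper // !upperE ?leq_subr // leqNgt ijn /= !PoszM.
have -> : (minn i k)%:Z = i%:Z - (i - k)%N%:Z by lia.
have -> : (i + k - n = i - (n - k))%N by lia.
have -> : (i + (n - k) - n = i - k)%N by lia.
rewrite -(subzn jn) -(subzn kn).
ring.
Qed.

(** Reduces the square to i <= j, the range of [sum_upper_lower]; the diagonal is counted twice and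
    subtracted once. *)
Lemma sum_symmetric (n : nat) (f : nat -> nat -> int) :
  (forall i j, f i j = f j i) ->
  \sum_(i < n.+1) \sum_(j < n.+1) f i j =
  2 * (\sum_(j < n.+1) \sum_(i < j.+1) f i j) - \sum_(i < n.+1) f i i.
Proof.
move=> fC; elim: n => [|n IHn]; first by rewrite !big_ord1 /=; ring.
rewrite big_ord_recr /=.
under eq_bigr do rewrite big_ord_recr /=.
rewrite big_split /= IHn [\sum_(j < n.+2) \sum_(i < j.+1) _]big_ord_recr /= ![\sum_(i < n.+2) f _ _]big_ord_recr /=.
have -> : \sum_(i < n.+1) f n.+1 i = \sum_(i < n.+1) f i n.+1.
  by apply: eq_bigr => i _; rewrite fC.
ring.
Qed.

Definition rank_sum (n : nat) : int :=
  \sum_(i < n.+1) \sum_(j < n.+1) \sum_(k < n.+1) (upper n i j k - lower n i j k).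

(** With a = i and b = n-j the region i <= j <= n becomes a+b <= n, and the diagonal i = j becomes
    a+b = n. *)
Lemma rank_sum_triangle (n : nat) :
  rank_sum n =
  2 * (\sum_(b < n.+1) \sum_(a < (n - b).+1) (row_rank n a b)%:Z)
  - \sum_(b < n.+1) (row_rank n (n - b) b)%:Z.
Proof.
rewrite /rank_sum (@sum_symmetric _
  (fun i j => \sum_(k < n.+1) (upper n i j k - lower n i j k))); last first.
  by move=> i j; apply: eq_bigr => k _; rewrite upper_symm12 lower_symm12.
congr (2 * _ - _).
  rewrite (reindex_inj rev_ord_inj) /=; apply: eq_bigr => b _.
  rewrite subSS; apply: eq_bigr => a _.
  have bn := ltn_ord b; have an := ltn_ord a.
  by rewrite sum_upper_lower; [congr (row_rank _ _ _)%:Z| |]; lia.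
rewrite (reindex_inj rev_ord_inj) /=; apply: eq_bigr => b _.
have bn := ltn_ord b; rewrite subSS.
by rewrite sum_upper_lower ?leq_subr // subKn.
Qed.

(** * Sums over antidiagonals a + b = n and triangles a + b <= n *)

Definition antidiag (h : nat -> nat -> int) (n : nat) : int :=
  \sum_(b < n.+1) h (n - b)%N b.

Definition triangle (h : nat -> nat -> int) (n : nat) : int :=
  \sum_(b < n.+1) \sum_(a < (n - b).+1) h a b.

Lemma triangle0 h : triangle h 0 = h 0%N 0%N.
Proof. by rewrite /triangle !big_ord1. Qed.

Lemma triangleS h n : triangle h n.+1 = triangle h n + antidiag h n.+1.
Proof.
have -> : antidiag h n.+1 = \sum_(b < n.+1) h (n.+1 - b)%N b + h 0%N n.+1.
  by rewrite /antidiag big_ord_recr /= subnn.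
rewrite /triangle big_ord_recr /= subnn big_ord1 addrA.
congr (_ + _); rewrite -big_split /=; apply: eq_bigr => b _.
by rewrite subSn -1?ltnS // big_ord_recr.
Qed.

Lemma antidiag0 h : antidiag h 0 = h 0%N 0%N.
Proof. by rewrite /antidiag big_ord1. Qed.

Lemma antidiag1 h : antidiag h 1 = h 1%N 0%N + h 0%N 1%N.
Proof. by rewrite /antidiag big_ord_recr big_ord1. Qed.

(** Removing both end points and shifting by (1,1) lowers n by two. This recursion preserves the
    parity of n and raises max(a,b) by exactly 1. *)
Lemma antidiagSS h n :
  antidiag h n.+2 = h n.+2 0%N + antidiag (fun a b => h a.+1 b.+1) n + h 0%N n.+2.
Proof.
rewrite /antidiag big_ord_recr big_ord_recl /= subnn subn0; congr (_ + _ + _).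
by apply: eq_bigr => b _; rewrite /bump leq0n add1n subSS subSn // -ltnS.
Qed.

Lemma eq_antidiag h1 h2 n : (forall a b, (a + b)%N = n -> h1 a b = h2 a b) ->
  antidiag h1 n = antidiag h2 n.
Proof. by move=> e; apply: eq_bigr => b _; apply: e; rewrite subnK // -ltnS. Qed.

Lemma antidiagD h1 h2 n :
  antidiag (fun a b => h1 a b + h2 a b) n = antidiag h1 n + antidiag h2 n.
Proof. exact: big_split. Qed.

Lemma antidiagZ c h n : antidiag (fun a b => c * h a b) n = c * antidiag h n.
Proof. by rewrite /antidiag mulr_sumr. Qed.

Lemma antidiag_const c n : antidiag (fun _ _ => c) n = c * n.+1%:Z.
Proof. by rewrite /antidiag sumr_const card_ord -mulr_natr natz. Qed.

Lemma triangleD h1 h2 n :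
  triangle (fun a b => h1 a b + h2 a b) n = triangle h1 n + triangle h2 n.
Proof. by rewrite /triangle -big_split; apply: eq_bigr => b _; apply: big_split. Qed.

Lemma triangleZ c h n : triangle (fun a b => c * h a b) n = c * triangle h n.
Proof. by rewrite /triangle mulr_sumr; apply: eq_bigr => b _; rewrite mulr_sumr. Qed.

Lemma nat_ind2 (P : nat -> Prop) :
  P 0%N -> P 1%N -> (forall n, P n -> P n.+2) -> forall n, P n.
Proof.
move=> P0 P1 PS n; suff [] : P n /\ P n.+1 by [].
by elim: n => // n [Pn Pn1]; split=> //; apply: PS.
Qed.

Definition prodZ (a b : nat) : int := a%:Z * b%:Z.
Definition maxZ (a b : nat) : int := (maxn a b)%:Z.
Definition prod_maxZ (a b : nat) : int := prodZ a b * maxZ a b.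

Lemma antidiag_prod n : 6 * antidiag prodZ n = n%:Z ^+ 3 - n%:Z.
Proof.
elim/nat_ind2: n => [||n IHn]; rewrite ?antidiag0 ?antidiag1 // antidiagSS.
(* On a+b = n one has (a+1)(b+1) = ab + n+1. *)
rewrite (@eq_antidiag _ (fun a b => prodZ a b + n.+1%:Z)); last first.
  by move=> a b <-; rewrite /prodZ; lia.
rewrite antidiagD antidiag_const /prodZ mulr0 mul0r add0r addr0 mulrDr IHn.
have -> : n.+2%:Z = n%:Z + 2 by lia.
have -> : n.+1%:Z = n%:Z + 1 by lia.
ring.
Qed.

Lemma antidiag_max n : 4 * antidiag maxZ n = 3 * n%:Z ^+ 2 + 4 * n%:Z + (odd n)%:Z.
Proof.
elim/nat_ind2: n => [||n IHn]; rewrite ?antidiag0 ?antidiag1 // antidiagSS.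
rewrite (@eq_antidiag _ (fun a b => maxZ a b + 1)); last first.
  by move=> a b _; rewrite /maxZ; lia.
rewrite antidiagD antidiag_const !mulrDr IHn /maxZ maxn0 max0n /= negbK.
have -> : n.+2%:Z = n%:Z + 2 by lia.
have -> : n.+1%:Z = n%:Z + 1 by lia.
ring.
Qed.

Lemma antidiag_prod_max n :
  96 * antidiag prod_maxZ n =
  11 * n%:Z ^+ 4 - 20 * n%:Z ^+ 2 + (odd n)%:Z * (3 + 6 * n%:Z ^+ 2).
Proof.
elim/nat_ind2: n => [||n IHn]; rewrite ?antidiag0 ?antidiag1 // antidiagSS.
(* With m = max(a,b) this expands (ab + n+1)(m+1). *)
rewrite (@eq_antidiag _ (fun a b => prod_maxZ a b + prodZ a b
                                    + (n.+1%:Z * maxZ a b + n.+1%:Z))); last first.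
  move=> a b <-; rewrite /prod_maxZ /prodZ /maxZ maxnSS.
  by move: (maxn a b) => m; rewrite !intS PoszD; ring.
rewrite !antidiagD antidiagZ antidiag_const.
have hP := antidiag_prod n; have hM := antidiag_max n.
have -> : prod_maxZ n.+2 0 = 0 by rewrite /prod_maxZ /prodZ mulr0 mul0r.
have -> : prod_maxZ 0 n.+2 = 0 by rewrite /prod_maxZ /prodZ !mul0r.
rewrite add0r addr0 /= negbK.
have -> : n.+2%:Z = n%:Z + 2 by lia.
have -> : n.+1%:Z = n%:Z + 1 by lia.
(* The factor 96 is split as 16 * 6 and 24 * 4 to expose the left sides of the two earlier closed
   forms. *)
transitivity (96 * antidiag prod_maxZ n + 16 * (6 * antidiag prodZ n)
    + 24 * (n%:Z + 1) * (4 * antidiag maxZ n) + 96 * (n%:Z + 1) ^+ 2).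
  by ring.
by rewrite IHn hP hM; ring.
Qed.

Lemma triangle_prod n :
  24 * triangle prodZ n = n%:Z ^+ 4 + 2 * n%:Z ^+ 3 - n%:Z ^+ 2 - 2 * n%:Z.
Proof.
elim: n => [|n IHn]; first by rewrite triangle0.
rewrite triangleS mulrDr IHn; have := antidiag_prod n.+1.
have -> : n.+1%:Z = n%:Z + 1 by lia.
lra.
Qed.

Lemma triangle_prod_max n :
  960 * triangle prod_maxZ n =
  22 * n%:Z ^+ 5 + 55 * n%:Z ^+ 4 - 20 * n%:Z ^+ 3 - 100 * n%:Z ^+ 2 - 32 * n%:Z
  + (odd n)%:Z * (15 + 30 * n%:Z + 30 * n%:Z ^+ 2).
Proof.
elim: n => [|n IHn]; first by rewrite triangle0.
rewrite triangleS mulrDr IHn; have := antidiag_prod_max n.+1; rewrite /=.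
have -> : n.+1%:Z = n%:Z + 1 by lia.
(* The parity of n+1 is opposite to that of n; once it is fixed, a polynomial identity remains. *)
by case: (odd n) => /=; lra.
Qed.

(** * The rank formula *)

Lemma rank_sum_closed n :
  240 * rank_sum n = 9 * n%:Z ^+ 5 - 10 * n%:Z ^+ 3 + (if odd n then 1 else 16) * n%:Z.
Proof.
rewrite rank_sum_triangle.
(* On the triangle max(a,b) <= n, so the truncated subtraction in [row_rank] is exact and the
   product expands. *)
have rowE a b : (a + b <= n)%N ->
    (row_rank n a b)%:Z = n%:Z * prodZ a b + (-1) * prod_maxZ a b.
  move=> abn; rewrite /row_rank /prod_maxZ /prodZ /maxZ.
  have mn : (maxn a b <= n)%N by lia.
  by move: mn; move: (maxn a b) => m mn; rewrite !PoszM -subzn //; ring.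
have -> : \sum_(b < n.+1) (row_rank n (n - b) b)%:Z =
    n%:Z * antidiag prodZ n + (-1) * antidiag prod_maxZ n.
  rewrite -!antidiagZ -antidiagD; apply: eq_bigr => b _; apply: rowE.
  by rewrite subnK // -ltnS.
have -> : \sum_(b < n.+1) \sum_(a < (n - b).+1) (row_rank n a b)%:Z =
    n%:Z * triangle prodZ n + (-1) * triangle prod_maxZ n.
  rewrite -!triangleZ -triangleD; apply: eq_bigr => b _; apply: eq_bigr => a _.
  by apply: rowE; have := ltn_ord a; have := ltn_ord b; lia.
have := antidiag_prod n; have := antidiag_prod_max n.
have := triangle_prod n; have := triangle_prod_max n.
move: (antidiag _ n) (antidiag _ n) (triangle _ n) (triangle _ n) => P Q U V hV hU hQ hP.
by case: (odd n) hV hQ => /= hV hQ; nra.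
Qed.

Lemma entry_sum_hm_of (n : nat) (f : nat -> nat -> nat -> int) :
  entry_sum (hm_of n f) = \sum_(i < n.+1) \sum_(j < n.+1) \sum_(k < n.+1) f i j k.
Proof.
rewrite /entry_sum pair_big pair_big /=; apply: eq_bigr => x _.
by rewrite ffunE.
Qed.

Lemma entry_sum_upper_lower (n : nat) :
  entry_sum (hm_of n (upper n)) = entry_sum (hm_of n (lower n)) + rank_sum n.
Proof.
rewrite !entry_sum_hm_of /rank_sum -big_split; apply: eq_bigr => i _ /=.
rewrite -big_split; apply: eq_bigr => j _ /=; rewrite -big_split; apply: eq_bigr => k _ /=.
by rewrite addrC subrK.
Qed.

(* Graded: maximal chains exist and all have the same length, equal to the formula. *)
Theorem mainTheorem15 (n : nat) :
  (exists s : seq (hm n), maximal_chain s) /\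
  (forall s : seq (hm n), maximal_chain s ->
     (chain_length s)%:R =
       (9 * (n%:R) ^+ 5 - 10 * (n%:R) ^+ 3
        + (4 : rat) ^ (1 + (-1) ^+ n : int) * n%:R) / 240).
Proof.
have [cL cU] := (corner_sum_lower n, corner_sum_upper n).
have bound C : corner_sum C -> _ := @corner_sum_bounds n C.
have := entry_sum_upper_lower n.
have rank_ge0 : 0 <= rank_sum n.
  have [_ /entry_sum_le] := bound _ cL.
  by rewrite entry_sum_upper_lower lerDl.
(* The nonnegative integer [rank_sum n] is rewritten as a natural number, which serves as the [d] of
   the chain lemmas. *)
rewrite -(gez0_abs rank_ge0) => sumLU; split.
  have [s [ch sz]] := exists_full_chain cL cU bound sumLU.
  by exists s; apply: full_chain_maximal sumLU _ ch sz.
move=> s ms; rewrite /chain_length (size_maximal_chain cL cU bound sumLU ms) /=.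
have := rank_sum_closed n; rewrite -{1}(gez0_abs rank_ge0).
move/(congr1 (intr : int -> rat)).
(* The exponent is 0 for odd n and 2 for even n. *)
have -> : (4 : rat) ^ (1 + (-1) ^+ n : int) = (if odd n then 1 else 16).
  by rewrite -signr_odd; case: (odd n).
rewrite !(rmorph_nat, rmorph1, rmorphB, rmorphD, rmorphM, rmorphXn) /=.
rewrite -!pmulrn => e.
have nz240 : 240%:R != 0 :> rat by rewrite pnatr_eq0.
rewrite -[LHS](mulfK nz240); congr (_ / _).
rewrite mulrC e.
by case: (odd n); ring.
Qed.
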